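(* Let $\alpha>0$ and let $B\in\mathbb{R}^{n\times n}$ be a symmetric irreducible $M$-matrix. Consider the problem $$(P)\qquad \min_{x\in\mathbb{R}^n}\ \frac{\alpha}{2}\sum_{i=1}^n x_i^4+x^TBx\quad\text{s.t. } \|x\|_2^2=1 .$$ A stationary point $x$ of $(P)$ is a global minimizer of $(P)$ if and only if $x$ is the nonnegative (or the nonpositive) eigenvector of the nonlinear eigenvalue problem $$\alpha\,(x_1^3,\dots,x_n^3)^T+Bx=\lambda x,\qquad \|x\|_2=1 ,$$ i.e. if and only if $x\ge 0$ or $x\le 0$. Furthermore, when the constraint $x\ge0$ is added to $(P)$, the nonnegative eigenvector is the only global minimizer.
   Context: A pair $(\lambda,x)\in\mathbb{R}\times\mathbb{R}^n$ satisfying the displayed nonlinear eigenvalue problem is called an eigenpair, with eigenvector $x$; a stationary point of $(P)$ is precisely a vector $x\in\mathbb{R}^n$ that is an eigenvector for some $\lambda\in\mathbb{R}$. Vector inequalities are entrywise. A matrix $B\in\mathbb{R}^{n\times n}$ is reducible if there is a nonempty proper subset $I\subset\{1,\dots,n\}$ with $b_{ij}=0$ for all $i\in I$, $j\notin I$; otherwise it is irreducible. $B$ is an $M$-matrix if $B=sI-A$ with $A$ entrywise nonnegative and $s\ge\rho(A)$, where $\rho(A)$ is the spectral radius of $A$. *)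

(* Defs.v *)
From mathcomp Require Import all_boot all_order all_algebra.
From mathcomp Require Import boolp classical_sets reals.
From mathcomp Require Import complex.

Set Implicit Arguments.
Unset Strict Implicit.
Unset Printing Implicit Defensive.

Import Order.TTheory GRing.Theory Num.Theory.
Local Open Scope ring_scope.

Section Matrices.
Variables (R : realType) (n : nat).
Implicit Types (A B : 'M[R]_n) (x : 'cV[R]_n).

Definition reducible B : Prop :=
  exists I : {set 'I_n}, [/\ I != finset.set0, I \proper [set: 'I_n] &
    forall i j, i \in I -> j \notin I -> B i j = 0].

Definition irreducible_mx B : Prop := ~ reducible B.

(* The supremum is over the moduli of the complex eigenvalues of A. For n > 0
   this set is nonempty and finite, so [sup] is a maximum; for n = 0 it is
   empty and [sup] returns 0. *)
Definition spectral_radius A : R :=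
  sup [set r : R | exists2 z : R[i],
         eigenvalue (map_mx (real_complex R) A) z & r = ComplexField.Normc.normc z]%classic.

Definition M_matrix B : Prop :=
  exists s A, [/\ A \is a mxOver Num.nneg, spectral_radius A <= s &
    B = s%:M - A].

(* MathComp-Analysis equips matrices with the sup norm, hence this one. *)
Definition norm2 x : R := Num.sqrt (\sum_i x i 0 ^+ 2).

Definition objective (alpha : R) B x : R :=
  alpha / 2 * (\sum_i x i 0 ^+ 4) + (x^T *m B *m x) 0 0.

Definition eigenpair (alpha : R) B (lambda : R) x : Prop :=
  alpha *: (\col_i x i 0 ^+ 3) + B *m x = lambda *: x /\ norm2 x = 1.

Definition stationary (alpha : R) B x : Prop :=
  exists lambda, eigenpair alpha B lambda x.

Definition nonneg x : Prop := x \is a mxOver Num.nneg.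
Definition nonpos x : Prop := x \is a mxOver Num.npos.

Definition sphere : set 'cV[R]_n := [set x | norm2 x ^+ 2 = 1]%classic.
Definition nonneg_sphere : set 'cV[R]_n := (sphere `&` [set x | nonneg x])%classic.

Definition global_minimizer (f : 'cV[R]_n -> R) (S : set 'cV[R]_n) x : Prop :=
  S x /\ forall y, S y -> f x <= f y.

End Matrices.

Arguments sphere {R n}.
Arguments nonneg_sphere {R n}.

(* Main.v *)
Require Import Defs.
From mathcomp Require Import all_boot all_order all_algebra.
From mathcomp Require Import boolp classical_sets reals.
From mathcomp Require Import topology normedtype derive realfun.
From mathcomp Require Import ring lra.

(** Write a for [alpha], f for the objective and let x be an eigenvector with
    eigenvalue l all of whose entries are positive.  Any y can be written
    y_i = r_i x_i, and since B is symmetric and (Bx)_i = l x_i - a x_i^3, Picone's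
    identity for the quadratic form of B turns, for unit y, into the exact formula
      f(y) - f(x) = a/2 sum_i (y_i^2 - x_i^2)^2
                    - 1/2 sum_(i,j) b_ij x_i x_j (r_i - r_j)^2
    ([objective_gap]).  An M-matrix has nonpositive off-diagonal entries, so both
    terms on the right are nonnegative: a positive eigenvector is a global
    minimizer.  If f(y) = f(x) then b_ij = 0 whenever r_i <> r_j, and
    irreducibility forces r to be constant, that is y = x or y = -x
    ([positive_stationary_min]).  A nonnegative eigenvector is automatically
    positive, because the set of its zero entries would otherwise reduce B
    ([nonneg_stationary_gt0]); two nonnegative eigenvectors therefore both
    minimize f, and must coincide since neither is the opposite of the other.

    It remains to produce one.  By compactness f has a minimizer z on the sphere;
    taking absolute values does not increase f, as the off-diagonal entries of B
    are nonpositive, so |z| is a minimizer as well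
    ([exists_nonneg_sphere_min]).  That a minimizer on the sphere satisfies the
    eigenvalue equation ([sphere_min_stationary]) is the Lagrange condition, which
    is obtained here without multipliers: f is made homogeneous of degree 4, the
    constraint disappears, and along each coordinate line the minimum becomes a
    root of a nonnegative quartic polynomial, whose linear coefficient must
    vanish. *)

Import Order.TTheory GRing.Theory Num.Theory.
Import numFieldNormedType.Exports.
Local Open Scope ring_scope.

(** * The objective and the sphere *)

Lemma quad_formE (R : realType) (n : nat) (B : 'M[R]_n) (x : 'cV[R]_n) :
  (x^T *m B *m x) 0 0 = \sum_i x i 0 * (B *m x) i 0.
Proof. by rewrite -mulmxA mxE; apply: eq_bigr => i _; rewrite mxE. Qed.

Lemma norm2_sqr (R : realType) (n : nat) (x : 'cV[R]_n) :
  norm2 x ^+ 2 = \sum_i x i 0 ^+ 2.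
Proof. by rewrite sqr_sqrtr// sumr_ge0// => i _; rewrite sqr_ge0. Qed.

Lemma sphereE (R : realType) (n : nat) (x : 'cV[R]_n) :
  sphere x <-> norm2 x = 1.
Proof.
rewrite /sphere /=; split=> [/eqP|->]; last by rewrite expr1n.
by rewrite pexpr_eq1 ?sqrtr_ge0// => /eqP.
Qed.

Lemma nonnegP (R : realType) (n : nat) (x : 'cV[R]_n) :
  nonneg x <-> forall i, 0 <= x i 0.
Proof.
split=> [/mxOverP x0 i|x0]; first exact: x0.
by apply/mxOverP => i j; rewrite ord1; exact: x0.
Qed.

Lemma nonposN (R : realType) (n : nat) (x : 'cV[R]_n) :
  nonpos x <-> nonneg (- x).
Proof.
split=> /mxOverP h; apply/mxOverP => i j; have := h i j;
  by rewrite !mxE !qualifE /= oppr_ge0.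
Qed.

Lemma stationaryN (R : realType) (n : nat) (alpha : R) (B : 'M[R]_n)
    (x : 'cV[R]_n) :
  stationary alpha B x -> stationary alpha B (- x).
Proof.
move=> [l [e nx]]; exists l; split; last first.
  by rewrite -nx /norm2; congr Num.sqrt; apply: eq_bigr => i _; rewrite mxE sqrrN.
rewrite mulmxN scalerN -e opprD -scalerN; congr (_ *: _ + _).
by apply/colP => i; rewrite !mxE; ring.
Qed.

Lemma objectiveN (R : realType) (n : nat) (alpha : R) (B : 'M[R]_n)
    (x : 'cV[R]_n) :
  objective alpha B (- x) = objective alpha B x.
Proof.
rewrite /objective !quad_formE mulmxN; congr (_ * _ + _);
  by apply: eq_bigr => i _; rewrite !mxE; ring.
Qed.

(** * Positive eigenvectors are minimizers *)

Lemma M_matrix_offdiag_le0 (R : realType) (n : nat) (B : 'M[R]_n) i j :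
  M_matrix B -> i != j -> B i j <= 0.
Proof.
move=> [s [A [/mxOverP A0 _ ->]]] ij.
by rewrite !mxE (negbTE ij) mulr0n sub0r oppr_le0; exact: A0.
Qed.

(** Contrapositive form of irreducibility, which turns a property of one index
    into a property of all indices once it propagates along nonzero entries. *)
Lemma irreducible_closed_setT (R : realType) (n : nat) (B : 'M[R]_n)
    (I : {set 'I_n}) (k : 'I_n) :
  irreducible_mx B -> k \in I ->
  (forall i j, i \in I -> j \notin I -> B i j = 0) -> I = finset.setTfor 'I_n.
Proof.
move=> irr kI h; apply/eqP; apply: contrapT => /negP IT; apply: irr; exists I; split=> //.
  by apply/set0Pn; exists k.
by rewrite finset.properEneq IT finset.subsetT.
Qed.

(** At a vanishing entry i the eigenvalue equation reads sum_j b_ij x_j = 0, a sum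
    of nonpositive terms, so b_ij = 0 wherever x_j > 0: the zero set of x is closed
    in the sense of reducibility.  It cannot be everything, since x has norm 1. *)
Lemma nonneg_stationary_gt0 (R : realType) (n : nat) (alpha : R) (B : 'M[R]_n)
    (x : 'cV[R]_n) :
  (forall i j, i != j -> B i j <= 0) -> irreducible_mx B ->
  stationary alpha B x -> nonneg x -> forall i, 0 < x i 0.
Proof.
move=> Boff irr [l [e nx]] /nonnegP x0 k; rewrite lt_def x0 andbT.
apply/eqP => xk0; pose I := [set i | x i 0 == 0]%SET.
have IT : I = finset.setTfor 'I_n.
  apply: (@irreducible_closed_setT _ _ B I k); rewrite ?inE ?xk0 ?eqxx//.
  move=> i j; rewrite !inE => /eqP xi0 xj0.
  have /(congr1 (fun v : 'cV_n => v i 0)) := e.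
  rewrite !mxE xi0 expr0n mulr0 add0r mulr0 => s0.
  have : forall j, j \in predT -> - (B i j * x j 0) = 0.
    apply: psumr_eq0P => [p _|]; last by rewrite sumrN s0 oppr0.
    have [<-|ip] := eqVneq i p; first by rewrite xi0 mulr0 oppr0.
    by rewrite oppr_ge0 mulr_le0_ge0// Boff.
  move=> /(_ j isT) /eqP; rewrite oppr_eq0 mulf_eq0 (negbTE xj0) orbF.
  by move/eqP.
move: nx; rewrite /norm2 big1 ?sqrtr0 => [/esym/eqP|i _]; first by rewrite oner_eq0.
have : i \in I by rewrite IT finset.inE.
by rewrite inE => /eqP ->; rewrite expr0n.
Qed.

(** Expanding (r_i - r_j)^2 in the last sum gives 2 y^T B y minus twice
    sum_i r_i^2 x_i (Bx)_i, by symmetry of B; the eigenvalue equation evaluates the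
    latter, and the normalizations of x and y cancel the eigenvalue. *)
Lemma objective_gap (R : realType) (n : nat) (alpha : R) (B : 'M[R]_n)
    (x : 'cV[R]_n) (r : 'I_n -> R) :
  B^T = B -> stationary alpha B x -> norm2 (\col_i (r i * x i 0)) = 1 ->
  objective alpha B (\col_i (r i * x i 0)) - objective alpha B x =
    alpha / 2 * (\sum_i ((r i * x i 0) ^+ 2 - x i 0 ^+ 2) ^+ 2)
    + 2^-1 * \sum_i \sum_j - B i j * (x i 0 * x j 0 * (r i - r j) ^+ 2).
Proof.
move=> Bsym [l [e /(congr1 (fun t => t ^+ 2))]].
set y := \col_i _; rewrite norm2_sqr expr1n => nx.
move=> /(congr1 (fun t => t ^+ 2)); rewrite norm2_sqr expr1n => ny.
have Bx i : (B *m x) i 0 = l * x i 0 - alpha * x i 0 ^+ 3.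
  have /(congr1 (fun v : 'cV_n => v i 0)) := e.
  by rewrite !mxE => <-; ring.
have yE i : y i 0 = r i * x i 0 by rewrite mxE.
have rowE (g : 'I_n -> R) :
    \sum_i \sum_j B i j * (g i * (x i 0 * x j 0)) = \sum_i g i * x i 0 * (B *m x) i 0.
  apply: eq_bigr => i _; rewrite mxE mulr_sumr; apply: eq_bigr => j _; ring.
have colE : \sum_i \sum_j B i j * (r j ^+ 2 * (x i 0 * x j 0)) =
            \sum_i r i ^+ 2 * x i 0 * (B *m x) i 0.
  rewrite -rowE exchange_big; apply: eq_bigr => i _; apply: eq_bigr => j _ /=.
  by rewrite -[in LHS]Bsym mxE; ring.
have qE : (y^T *m B *m y) 0 0 = \sum_i \sum_j B i j * (r i * r j * (x i 0 * x j 0)).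
  rewrite quad_formE; apply: eq_bigr => i _; rewrite yE mxE mulr_sumr.
  by apply: eq_bigr => j _; rewrite !yE; ring.
have -> : \sum_i \sum_j - B i j * (x i 0 * x j 0 * (r i - r j) ^+ 2) =
    2 * (y^T *m B *m y) 0 0 - 2 * \sum_i r i ^+ 2 * x i 0 * (B *m x) i 0.
  rewrite qE mulr2n !mulrDl !mul1r -{1}rowE -colE opprD -!sumrN -!big_split /=.
  apply: eq_bigr => i _; rewrite -!sumrN -!big_split /=.
  apply: eq_bigr => j _; ring.
rewrite /objective (quad_formE _ _ B x).
have -> : \sum_i x i 0 * (B *m x) i 0 = l - alpha * \sum_i x i 0 ^+ 4.
  rewrite -[l]mulr1 -nx !mulr_sumr -sumrN -big_split /=.
  by apply: eq_bigr => i _; rewrite Bx; ring.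
have -> : \sum_i r i ^+ 2 * x i 0 * (B *m x) i 0 =
          l - alpha * \sum_i y i 0 ^+ 2 * x i 0 ^+ 2.
  rewrite -[l]mulr1 -ny !mulr_sumr -sumrN -big_split /=.
  by apply: eq_bigr => i _; rewrite Bx yE; ring.
have -> : \sum_i ((r i * x i 0) ^+ 2 - x i 0 ^+ 2) ^+ 2 =
   \sum_i y i 0 ^+ 4 - 2 * (\sum_i y i 0 ^+ 2 * x i 0 ^+ 2) + \sum_i x i 0 ^+ 4.
  rewrite !mulr_sumr -sumrN -!big_split /=.
  by apply: eq_bigr => i _; rewrite yE; ring.
by field.
Qed.

(** Both terms of the gap formula are nonnegative, and in the equality case the
    level set of the ratio r = y / x through one index is closed in the sense of
    reducibility, so y is a multiple of x. *)
Lemma positive_stationary_min (R : realType) (n : nat) (alpha : R) (B : 'M[R]_n)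
    (x y : 'cV[R]_n) :
  0 <= alpha -> B^T = B -> irreducible_mx B ->
  (forall i j, i != j -> B i j <= 0) ->
  stationary alpha B x -> (forall i, 0 < x i 0) -> norm2 y = 1 ->
  objective alpha B x <= objective alpha B y /\
  (objective alpha B y <= objective alpha B x -> y = x \/ y = - x).
Proof.
move=> a0 Bsym irr Boff stx x0 ny.
pose r i := y i 0 / x i 0.
have yE : y = \col_i (r i * x i 0).
  by apply/colP => i; rewrite mxE divfK// gt_eqF.
pose T i j := - B i j * (x i 0 * x j 0 * (r i - r j) ^+ 2).
have T0 i j : 0 <= T i j.
  have [<-|ij] := eqVneq i j; first by rewrite /T subrr expr0n !mulr0.
  by rewrite mulr_ge0 ?oppr_ge0 ?Boff// mulr_ge0 ?sqr_ge0// mulr_ge0// ltW.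
have row0 i : 0 <= \sum_j T i j by apply: sumr_ge0.
have all0 : 0 <= \sum_i \sum_j T i j by apply: sumr_ge0.
have := objective_gap _ _ alpha B x r Bsym stx; rewrite -yE => /(_ ny).
set Q := alpha / 2 * _ => gap.
have Q0 : 0 <= Q.
  by rewrite mulr_ge0 ?divr_ge0// sumr_ge0// => i _; rewrite sqr_ge0.
split; first by rewrite -subr_ge0 gap addr_ge0// mulr_ge0// invr_ge0.
rewrite -subr_le0 gap => le0.
have s0 : \sum_i \sum_j T i j = 0.
  by apply/eqP; rewrite eq_le all0 andbT; rewrite -/T in le0; lra.
have B0 i j : r i != r j -> B i j = 0.
  move=> rij.
  have Ti0 : \sum_j T i j = 0 by apply: (psumr_eq0P _ s0).
  have /eqP : T i j = 0 by apply: (psumr_eq0P _ Ti0).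
  rewrite /T !mulf_eq0 oppr_eq0 !subr_eq0 (negbTE rij).
  by rewrite !(gt_eqF (x0 _)) !orbF => /eqP.
have [k _|n0] := pickP (fun _ : 'I_n => true); last first.
  by left; apply/colP => i; have := n0 i.
have rk i : r i = r k.
  have IT : [set i | r i == r k]%SET = finset.setTfor 'I_n.
    apply: (@irreducible_closed_setT _ _ B _ k); rewrite ?inE//.
    by move=> p q; rewrite !inE => /eqP rp rq; apply: B0; rewrite rp eq_sym.
  have : i \in [set i | r i == r k]%SET by rewrite IT finset.inE.
  by rewrite inE => /eqP.
have yrx : y = r k *: x by rewrite yE; apply/colP => i; rewrite !mxE rk.
have [l [_ nx]] := stx.
have : norm2 y ^+ 2 = r k ^+ 2 * norm2 x ^+ 2.
  rewrite !norm2_sqr yrx mulr_sumr.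
  by apply: eq_bigr => i _; rewrite !mxE exprMn.
rewrite nx ny expr1n mulr1 => /esym/eqP.
rewrite sqrf_eq1 yrx => /orP[]/eqP ->; [left|right].
  by rewrite scale1r.
by rewrite scaleN1r.
Qed.

(** * Minimizers on the sphere are eigenvectors *)

(** First-order condition at the minimum t = 0 of a quartic polynomial. *)
Lemma linear_coef_eq0 (R : realType) (c d e g : R) :
  (forall t, 0 <= c * t + d * t ^+ 2 + e * t ^+ 3 + g * t ^+ 4) -> c = 0.
Proof.
move=> h; apply/eqP; case: eqVneq => // c0; exfalso.
pose K := `|c| + `|d| + `|e| + `|g|.
have ac : 0 < `|c| by rewrite normr_gt0.
have cK : `|c| <= K by rewrite /K -!addrA lerDl !addr_ge0.
have K0 : 0 < K by exact: lt_le_trans cK.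
(* For |t| <= 1 the last three terms are at most K t^2, while this t has
   c t = - 2 K t^2. *)
have := h (- c / (2 * K)); set t := - c / _.
have t1 : `|t| <= 1.
  by rewrite /t normrM normrN normfV (gtr0_norm (_ : 0 < 2 * K)) ?mulr_gt0// ler_pdivrMr; lra.
have tp p : 0 <= `|t| ^+ p <= 1 by rewrite exprn_ge0// exprn_ile1.
have b (u : R) p : u * t ^+ p.+2 <= `|u| * t ^+ 2.
  rewrite (le_trans (ler_norm _))// normrM normrX ler_wpM2l//.
  rewrite -[t ^+ 2]ger0_norm ?sqr_ge0// normrX -addn2 exprD ler_piMl ?exprn_ge0//.
  by case/andP: (tp p).
have := (b d 0%N, b e 1%N, b g 2%N) => -[[bd be] bg].
have ct : c * t = - (2 * K) * t ^+ 2 by rewrite /t; field; rewrite gt_eqF.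
have t2 : 0 < t ^+ 2 by rewrite exprn_even_gt0//= /t mulf_neq0 ?oppr_eq0// invr_eq0 gt_eqF// mulr_gt0.
have := mulr_gt0 ac t2; have := mulr_gt0 K0 t2.
rewrite ct {1 2}/K; nra.
Qed.

(** A lower bound of the objective on the sphere extends by scaling to an
    inequality between quartic forms on the whole space, which removes the
    constraint from the first-order condition. *)
Lemma objective_homogenized (R : realType) (n : nat) (alpha m : R)
    (B : 'M[R]_n) :
  (forall z : 'cV[R]_n, norm2 z = 1 -> m <= objective alpha B z) ->
  forall y : 'cV[R]_n,
    m * (\sum_i y i 0 ^+ 2) ^+ 2 <=
    alpha / 2 * (\sum_i y i 0 ^+ 4)
    + (y^T *m B *m y) 0 0 * \sum_i y i 0 ^+ 2.
Proof.
move=> hm y; rewrite -norm2_sqr; set N := norm2 y.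
have [N0|N0] := eqVneq N 0.
  have y0 i : y i 0 = 0.
    have /psumr_eq0P y2 : \sum_i y i 0 ^+ 2 = 0 by rewrite -norm2_sqr -/N N0 expr0n.
    by apply/eqP; rewrite -sqrf_eq0 y2// => j _; rewrite sqr_ge0.
  rewrite N0 !expr0n /= !mulr0 addr0 big1 ?mulr0// => i _.
  by rewrite y0 expr0n.
have nz : norm2 (N^-1 *: y) = 1.
  apply/sphereE; rewrite /sphere /= norm2_sqr.
  under eq_bigr do rewrite mxE exprMn.
  by rewrite -mulr_sumr -norm2_sqr -/N exprVn mulVf// expf_neq0.
have := hm _ nz; rewrite /objective !quad_formE -scalemxAr.
under eq_bigr do rewrite mxE exprMn.
under [X in _ + X]eq_bigr do rewrite mxE [X in _ * X]mxE mulrACA.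
rewrite -!mulr_sumr => h.
have N4 : 0 < N ^+ 4 by rewrite exprn_even_gt0.
rewrite -(ler_pM2r N4) in h.
move: h; set S4 := \sum_i y i 0 ^+ 4; set q := \sum_(i < n) _.
have -> : (alpha / 2 * (N^-1 ^+ 4 * S4) + N^-1 * N^-1 * q) * N ^+ 4 =
          alpha / 2 * S4 + q * N ^+ 2 by field.
by rewrite -exprM.
Qed.

(** The homogenized inequality is an equality at x.  Restricted to the line
    x + t e_k, it is a quartic polynomial in t vanishing at 0; its
    linear coefficient is twice the k-th entry of the eigenvalue equation, with
    multiplier 2 f(x) - x^T B x. *)
Lemma sphere_min_stationary (R : realType) (n : nat) (alpha : R) (B : 'M[R]_n)
    (x : 'cV[R]_n) :
  B^T = B -> global_minimizer (objective alpha B) sphere x ->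
  stationary alpha B x.
Proof.
move=> Bsym [/sphereE nx xmin]; set m := objective alpha B x in xmin.
have := @objective_homogenized _ _ alpha m B.
move=> /(_ (fun z nz => xmin z (proj2 (sphereE _ _ z) nz))) hom.
pose q := (x^T *m B *m x) 0 0.
have sx : \sum_i x i 0 ^+ 2 = 1 by rewrite -norm2_sqr nx expr1n.
have mE : m = alpha / 2 * (\sum_i x i 0 ^+ 4) + q by [].
exists (2 * m - q); split=> //; apply/colP => k.
pose y t : 'cV[R]_n := x + t *: delta_mx k 0.
have yE t i : y t i 0 = x i 0 + t * (i == k)%:R by rewrite !mxE andbT.
have sumE t (p : nat) : \sum_i y t i 0 ^+ p =
    \sum_i x i 0 ^+ p + ((x k 0 + t) ^+ p - x k 0 ^+ p).
  rewrite (bigD1 k)//= [in RHS](bigD1 k)//= yE eqxx mulr1.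
  rewrite (eq_bigr (fun i => x i 0 ^+ p)); first by ring.
  by move=> i /negbTE ik; rewrite yE ik mulr0 addr0.
have deltaE (v : 'cV[R]_n) : ((delta_mx k 0 : 'cV[R]_n)^T *m v) 0 0 = v k 0.
  by rewrite trmx_delta -rowE mxE.
have xBd : (x^T *m B *m (delta_mx k 0 : 'cV[R]_n)) 0 0 = (B *m x) k 0.
  have tr00 (u : 'M[R]_1) : u 0 0 = u^T 0 0 by rewrite mxE.
  by rewrite tr00 !trmx_mul trmxK Bsym deltaE.
have yBy t : ((y t)^T *m B *m y t) 0 0 = q + 2 * t * (B *m x) k 0 + t ^+ 2 * B k k.
  have -> : (y t)^T = x^T + t *: (delta_mx k 0 : 'cV[R]_n)^T.
    by rewrite /y linearD linearZ.
  rewrite mulmxDr -scalemxAr !mulmxDl -!scalemxAl.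
  have addE (u v : 'M[R]_1) : (u + v) 0 0 = u 0 0 + v 0 0 by rewrite mxE.
  have sclE a (u : 'M[R]_1) : (a *: u) 0 0 = a * u 0 0 by rewrite mxE.
  rewrite !(addE, sclE) xBd -/q -!mulmxA !deltaE -colE.
  by set b := (B *m x) k 0; rewrite mxE; ring.
have /eqP :
    2 * (alpha * x k 0 ^+ 3 + (B *m x) k 0 - (2 * m - q) * x k 0) = 0.
  apply: (linear_coef_eq0 _ _
    (3 * alpha * x k 0 ^+ 2 + B k k + q + 4 * x k 0 * (B *m x) k 0
       - m * (2 + 4 * x k 0 ^+ 2))
    (2 * alpha * x k 0 + 2 * (B *m x) k 0 + 2 * x k 0 * B k k - 4 * m * x k 0)
    (alpha / 2 + B k k - m)) => t.
  have := hom (y t); rewrite yBy !sumE sx -subr_ge0.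
  congr (_ <= _); by rewrite mE; field.
rewrite mulf_eq0 pnatr_eq0 /= subr_eq0 => /eqP.
have addE (u v : 'cV[R]_n) : (u + v) k 0 = u k 0 + v k 0 by rewrite mxE.
by rewrite addE => h; rewrite [RHS]mxE -h; congr (_ + _); rewrite !mxE.
Qed.

(** * Existence of a nonnegative eigenvector *)

Lemma exists_sphere_min (R : realType) (n : nat) (alpha : R) (B : 'M[R]_n) :
  (0 < n)%N ->
  exists x, global_minimizer (objective alpha B) sphere x.
Proof.
move=> n0; pose f (u : 'rV[R]_n) := objective alpha B u^T.
pose S : set 'rV[R]_n := [set u | \sum_i u 0 i ^+ 2 = 1]%classic.
have Xcont p i : continuous (fun u : 'rV[R]_n => u 0 i ^+ p).
  move=> u; apply: (@continuous_comp _ _ _ (fun v : 'rV[R]_n => v 0 i) (fun t => t ^+ p)).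
    exact: coord_continuous.
  exact: exprn_continuous.
have cstcont (a : R) : continuous (fun _ : 'rV[R]_n => a) by exact: cst_continuous.
have addcont (g h : 'rV[R]_n -> R) : continuous g -> continuous h ->
    continuous (fun u => g u + h u).
  by move=> gc hc u; exact: (continuousD (gc u) (hc u)).
have mulcont (g h : 'rV[R]_n -> R) : continuous g -> continuous h ->
    continuous (fun u => g u * h u).
  by move=> gc hc u; exact: (continuousM (gc u) (hc u)).
have sumcont (g : 'I_n -> 'rV[R]_n -> R) : (forall i, continuous (g i)) ->
    continuous (fun u => \sum_i g i u).
  by move=> gc; apply: continuous_big => //; exact: add_continuous.
have Ncont : continuous (fun u : 'rV[R]_n => \sum_i u 0 i ^+ 2).
  by apply: sumcont => i; exact: Xcont.
(* The exponents 1 bring all coordinate functions under [Xcont]. *)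
have fE : f = fun u => alpha / 2 * (\sum_i u 0 i ^+ 4)
                    + \sum_i u 0 i ^+ 1 * \sum_j B i j * u 0 j ^+ 1.
  apply/funext => u; rewrite /f /objective quad_formE; congr (_ * _ + _).
    by apply: eq_bigr => i _; rewrite mxE.
  apply: eq_bigr => i _; rewrite !mxE expr1; congr (_ * _).
  by apply: eq_bigr => j _; rewrite mxE expr1.
have fcont : continuous f.
  rewrite fE; apply: addcont.
    by apply: mulcont => //; apply: sumcont => i; exact: Xcont.
  apply: (sumcont) => i; apply: (mulcont) => //; apply: sumcont => j.
  by apply: mulcont => //; exact: Xcont.
have Scompact : compact S.
  apply: (@subclosed_compact _ _ [set u : 'rV[R]_n | forall i, `[-1, 1]%classic (u ord0 i)]%classic).
  - apply: (@preimage_closed _ _ (fun u : 'rV[R]_n => \sum_i u 0 i ^+ 2) [set 1]%classic) => //.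
  - apply: (@rV_compact R n (fun=> `[-1, 1]%classic)) => _.
    exact: segment_compact.
  - move=> u uS i /=; rewrite in_itv /= -ler_norml -(@ler_pXn2r _ 2)// ?nnegrE//.
    rewrite expr1n real_normK ?num_real// -uS (bigD1 i)//= lerDl.
    by apply: sumr_ge0 => j _; rewrite sqr_ge0.
have S0 : (S !=set0)%classic.
  exists (delta_mx 0 (Ordinal n0)); rewrite /S /= (bigD1 (Ordinal n0))//= mxE !eqxx.
  rewrite expr1n big1 ?addr0// => i /negbTE ik.
  by rewrite mxE ik andbF expr0n.
have SE (u : 'rV[R]_n) : u \in S <-> sphere u^T.
  rewrite inE /S /sphere /= norm2_sqr.
  by under [X in _ <-> (X = _)]eq_bigr do rewrite mxE.
have [c cS cmin] := EVT_min_rV S0 Scompact (continuous_subspaceT fcont).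
exists c^T; split; first exact/SE.
by move=> y yS; rewrite -[y]trmxK; apply: cmin; apply/SE; rewrite trmxK.
Qed.

(** Replacing the entries of a minimizer by their absolute values leaves the
    quartic term and the diagonal part of the quadratic form unchanged, and can
    only decrease its off-diagonal part. *)
Lemma exists_nonneg_sphere_min (R : realType) (n : nat) (alpha : R) (B : 'M[R]_n) :
  (0 < n)%N -> (forall i j, i != j -> B i j <= 0) ->
  exists2 x, nonneg x & global_minimizer (objective alpha B) sphere x.
Proof.
move=> n0 Boff; have [z [zS zmin]] := exists_sphere_min _ _ alpha B n0.
pose x : 'cV[R]_n := \col_i `|z i 0|.
exists x; first by apply/nonnegP => i; rewrite mxE.
split.
  move: zS; rewrite /sphere /= !norm2_sqr => <-.
  by apply: eq_bigr => i _; rewrite mxE real_normK ?num_real.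
move=> y yS; apply: le_trans (zmin y yS); rewrite /objective lerD//.
  rewrite le_eqVlt; apply/orP; left; apply/eqP; congr (_ * _).
  apply: eq_bigr => i _; rewrite mxE -[4%N]/(2 * 2)%N !exprM.
  by rewrite real_normK ?num_real.
rewrite !quad_formE ler_sum// => i _; rewrite !mxE !mulr_sumr ler_sum// => j _.
rewrite mxE mulrCA [leRHS]mulrCA -normrM; have [<-|ij] := eqVneq i j.
  by rewrite ger0_norm// -expr2 sqr_ge0.
by rewrite ler_wnM2l ?Boff ?ler_norm.
Qed.

Theorem theorem3p15 (R : realType) (n : nat) (n_gt0 : (0 < n)%N)
    (alpha : R) (B : 'M[R]_n) (alpha_gt0 : 0 < alpha)
    (B_sym : B^T = B) (B_irr : irreducible_mx B) (B_M : M_matrix B) :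
  exists xp xm : 'cV[R]_n,
    [/\ unique (fun x => stationary alpha B x /\ nonneg x) xp,
        unique (fun x => stationary alpha B x /\ nonpos x) xm,
        forall x : 'cV[R]_n, stationary alpha B x ->
          (global_minimizer (objective alpha B) sphere x <-> x = xp \/ x = xm) /\
          (global_minimizer (objective alpha B) sphere x <-> nonneg x \/ nonpos x)
      & forall x : 'cV[R]_n,
          global_minimizer (objective alpha B) nonneg_sphere x <-> x = xp].
Proof.
have Boff i j : i != j -> B i j <= 0 by exact: M_matrix_offdiag_le0.
have [xp xp0 xpmin] := exists_nonneg_sphere_min _ _ alpha B n_gt0 Boff.
have xpst := sphere_min_stationary _ _ _ _ _ B_sym xpmin.
have xp_gt0 := nonneg_stationary_gt0 _ _ _ _ _ Boff B_irr xpst xp0.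
have cmp y : norm2 y = 1 -> objective alpha B y <= objective alpha B xp ->
    y = xp \/ y = - xp.
  by move=> ny; apply: (proj2 (positive_stationary_min _ _ _ _ _ _ (ltW alpha_gt0)
    B_sym B_irr Boff xpst xp_gt0 ny)).
have npN : ~ nonneg (- xp).
  move=> /nonnegP /(_ (Ordinal n_gt0)); rewrite mxE oppr_ge0.
  by rewrite leNgt xp_gt0.
have nonneg_min y : norm2 y = 1 -> nonneg y ->
    objective alpha B y <= objective alpha B xp -> y = xp.
  by move=> ny y0 /(cmp _ ny) [//|yN]; rewrite yN in y0.
have nonneg_uniq y : stationary alpha B y -> nonneg y -> y = xp.
  move=> yst y0; have [l [_ ny]] := yst; apply: nonneg_min => //.
  have y_gt0 := nonneg_stationary_gt0 _ _ _ _ _ Boff B_irr yst y0.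
    (* Any other candidate y is positive too, so the comparison applies with y as
     base point and xp as competitor. *)
have [_ [_ nxp]] := xpst.
  by case: (positive_stationary_min _ _ _ _ y xp (ltW alpha_gt0)
    B_sym B_irr Boff yst y_gt0 nxp).
have nonpos_uniq y : stationary alpha B y -> nonpos y -> y = - xp.
  move=> yst /nonposN y0.
  by rewrite -(nonneg_uniq (- y)) ?opprK//; exact: stationaryN.
have xmst := stationaryN _ _ _ _ _ xpst.
have xm0 : nonpos (- xp) by apply/nonposN; rewrite opprK.
have xmmin : global_minimizer (objective alpha B) sphere (- xp).
  have [_ [_ nxm]] := xmst; split; first exact/sphereE.
  by move=> y yS; rewrite objectiveN; exact: (proj2 xpmin).
exists xp, (- xp); split.
- by split=> // y [yst y0]; rewrite (nonneg_uniq y).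
- by split=> // y [yst y0]; rewrite (nonpos_uniq y).
- move=> x xst.
  have minE : global_minimizer (objective alpha B) sphere x <-> x = xp \/ x = - xp.
    split=> [[/sphereE nx xmin]|[]->//].
    by apply: cmp => //; apply: xmin; exact: (proj1 xpmin).
  split=> //; split=> [/minE[]->|[x0|x0]]; [by left|by right| |]; apply/minE.
    by left; exact: nonneg_uniq.
  by right; exact: nonpos_uniq.
- move=> x; split=> [[[/sphereE nx x0] xmin]|->].
    by apply: nonneg_min => //; apply: xmin; split=> //; exact: (proj1 xpmin).
  split; first by split=> //; exact: (proj1 xpmin).
  by move=> y [yS _]; exact: (proj2 xpmin).
Qed.
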